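(* Let $n\ge 1$ and let $(X,\rho)$ be a finite metric space with $|X|=n+1$ whose metric $\rho$ is generic. Then for every integer $m$ with $0\le m\le n$, the number of $(n-m)$-dimensional faces of the $n$-dimensional polytope $\mathrm{LIP}(X)$ equals $$\binom{n+m}{m,m,n-m}=\frac{(n+m)!}{m!\,m!\,(n-m)!}.$$
   Context: Let $(X,\rho)$ be a finite metric space with $|X|=n+1$. The metric $\rho$ is called strict if $\rho(x,z)<\rho(x,y)+\rho(y,z)$ for all $x,z\in X$ and $y\in X\setminus\{x,z\}$. Fix $x_0\in X$ and let $F=\{f:X\to\mathbb{R} : f(x_0)=0\}$, an $n$-dimensional real vector space. $\mathrm{LIP}(X)=\{f\in F: |f(x)-f(y)|\le\rho(x,y)\ \text{for all } x,y\in X\}$ is an $n$-dimensional convex polytope (the polytope itself is counted as its own $n$-dimensional face). The dual space $F^*$ is identified with the space of signed measures $\mu=\sum_{x\in X}c_x\delta_x$ on $X$ with $\sum_x c_x=0$, with pairing $\langle\mu,f\rangle=\sum_x c_xf(x)$. For $x\neq y$ put $e_{x,y}=\frac{\delta_x-\delta_y}{\rho(x,y)}\in F^*$; the polytope $\mathrm{KR}(X)$ is the convex hull of all $e_{x,y}$, $x\ne y$, and is dual (polar) to $\mathrm{LIP}(X)$. The metric $\rho$ is called generic if $\rho$ is strict and $\mathrm{KR}(X)$ is a simplicial polytope (equivalently, $\rho$ is strict and $\mathrm{LIP}(X)$ is a simple polytope). *)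

(* Defs.v *)
From HB Require Import structures.
From mathcomp Require Export all_boot all_order all_algebra.
From mathcomp Require Export boolp classical_sets functions cardinality reals.

Set Implicit Arguments.
Unset Strict Implicit.
Unset Printing Implicit Defensive.

Import Order.TTheory GRing.Theory Num.Theory.

Local Open Scope classical_set_scope.
Local Open Scope ring_scope.

Definition affine_hull (R : realType) (V : lmodType R) (S : set V) : set V :=
  [set v | exists (k : nat) (w : 'I_k -> R) (s : 'I_k -> V),
     [/\ forall i, S (s i), \sum_i w i = 1 & v = \sum_i w i *: s i]].

Definition convex_hull (R : realType) (V : lmodType R) (S : set V) : set V :=
  [set v | exists (k : nat) (w : 'I_k -> R) (s : 'I_k -> V),
     [/\ forall i, S (s i), forall i, 0 <= w i, \sum_i w i = 1
       & v = \sum_i w i *: s i]].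

Definition affinely_independent (R : realType) (V : lmodType R) (k : nat)
    (s : 'I_k -> V) : Prop :=
  forall w : 'I_k -> R,
    \sum_i w i = 0 -> \sum_i w i *: s i = 0 -> forall i, w i = 0.

(* The dimension of a set is that of its affine hull; the empty set has no
   dimension in this sense, so the empty face is never counted below. *)
Definition has_dim (R : realType) (V : vectType R) (S : set V) (d : nat)
    : Prop :=
  exists (p : V) (U : {vspace V}),
    affine_hull S = [set v | v - p \in U] /\ \dim U = d.

(* Taking l = 0 makes P itself (c = 0) and the empty set (c = 1) faces of P. *)
Definition is_face (R : realType) (V : lmodType R) (P G : set V) : Prop :=
  exists (l : {scalar V}) (c : R),
    (forall v, P v -> l v <= c) /\ G = P `&` [set v | l v = c].

(* The case k = 0 is the empty simplex. *)
Definition is_simplex (R : realType) (V : lmodType R) (S : set V) : Prop :=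
  exists (k : nat) (s : 'I_k -> V),
    affinely_independent s /\ S = convex_hull (range s).

Definition simplicial (R : realType) (V : lmodType R) (P : set V) : Prop :=
  forall G : set V, is_face P G -> G <> P -> is_simplex G.

Definition is_metric (R : realType) (X : finType) (rho : X -> X -> R) : Prop :=
  [/\ forall x y, 0 <= rho x y,
      forall x y, rho x y = 0 <-> x = y,
      forall x y, rho x y = rho y x
    & forall x y z, rho x z <= rho x y + rho y z].

Definition strict_metric (R : realType) (X : finType) (rho : X -> X -> R)
    : Prop :=
  forall x y z, y != x -> y != z -> rho x z < rho x y + rho y z.

(* Both polytopes are viewed inside R^X: LIP lies in the subspace of functions
   vanishing at x0, and KR in the subspace of coefficient families c with
   \sum_x c x = 0, where c stands for the signed measure \sum_x c x * delta_x.
   Every linear functional on a subspace extends to R^X, so faces and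
   dimensions do not depend on the ambient space.  The codomain is R^o because
   the vector space structure on finite functions needs a codomain that is
   itself a vector space. *)
Definition LIP (R : realType) (X : finType) (rho : X -> X -> R) (x0 : X)
    : set {ffun X -> R^o} :=
  [set f | f x0 = 0 /\ forall x y, `|f x - f y| <= rho x y].

Definition delta (R : realType) (X : finType) (x : X) : {ffun X -> R^o} :=
  [ffun z => (z == x)%:R].

Definition KR_point (R : realType) (X : finType) (rho : X -> X -> R) (x y : X)
    : {ffun X -> R^o} :=
  (rho x y)^-1 *: (delta R x - delta R y).

Definition KR (R : realType) (X : finType) (rho : X -> X -> R)
    : set {ffun X -> R^o} :=
  convex_hull [set e | exists x y : X, x != y /\ e = KR_point rho x y].

Definition generic_metric (R : realType) (X : finType) (rho : X -> X -> R)
    : Prop :=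
  strict_metric rho /\ simplicial (KR rho).

(* Main.v *)
(* Call [(x, y)] tight for a 1-Lipschitz [f] when [x <> y] and
   [f x - f y = rho x y], and call a set of pairs admissible when it is the
   tight set of some [f].  Nonempty faces of LIP correspond to admissible sets
   [E]; genericity makes the vectors [delta x - delta y], [(x, y)] in [E],
   linearly independent, so the face of [E] has dimension [n - #|E|], and every
   subset of an admissible set is admissible.

   To count admissible sets, take pairs [(u, v)] of functions [X -> nat] of
   total mass [N]; there are ['C(N + n, n) ^ 2] of them.  By transport duality
   each is the pair of marginals of exactly one integral plan on [X * X] whose
   support off the diagonal is admissible: a plan with tight support exists by
   the Hungarian method (strictness leaves room for the mass kept on the
   diagonal), and it is unique by linear independence.  A given [E] supports
   ['C(N + n, n + #|E|)] plans, so the number [f k] of admissible sets of size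
   [k] satisfies [\sum_k f k * 'C(N + n, n + k) = 'C(N + n, n) ^ 2] for all [N].
   By the Vandermonde identity the unique solution is
   [f k = 'C(n, k) * 'C(n + k, n)]. *)

From HB Require Import structures.
Require Import Defs.
From mathcomp Require Import zify ring lra.

Set Implicit Arguments.
Unset Strict Implicit.
Unset Printing Implicit Defensive.

Import Order.TTheory GRing.Theory Num.Theory.

(** * Compositions and binomial identities *)

(** Stars and bars. The codomain ['I_N.+1] only makes the type finite: no summand of [N] exceeds
    [N]. *)
Lemma card_ffun_sum (D : finType) (d N : nat) : #|D| = d.+1 ->
  #|[set c : {ffun D -> 'I_N.+1} | (\sum_x c x == N)%N]| = 'C(d + N, d).
Proof.
move=> cD; rewrite -card_ord_partitions -!sum1dep_card.
pose cast (i : 'I_d.+1) : 'I_#|D| := cast_ord (esym cD) i.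
pose h (t : d.+1.-tuple 'I_N.+1) : {ffun D -> 'I_N.+1} :=
  [ffun x => tnth t (cast_ord cD (enum_rank x))].
rewrite (reindex h) /=; last first.
  exists (fun c : {ffun D -> 'I_N.+1} => [tuple c (enum_val (cast i)) | i < d.+1]).
    move=> t _; apply: eq_from_tnth => i.
    by rewrite tnth_mktuple ffunE enum_valK cast_ordKV.
  move=> c _; apply/ffunP => x.
  by rewrite ffunE tnth_mktuple /cast cast_ordK enum_rankK.
apply: eq_bigl => t; congr (_ == _).
rewrite big_tuple (reindex (fun x : D => cast_ord cD (enum_rank x))) /=.
  by apply: eq_bigr => x _; rewrite ffunE.
exists (fun i => enum_val (cast i)) => [x _|i _] /=.
  by rewrite /cast cast_ordK enum_rankK.
by rewrite enum_valK cast_ordKV.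
Qed.

(** Taking one unit away from each point of [E] leaves an arbitrary distribution of [N - #|E|] units
    over [D]. *)
Lemma card_ffun_sum_supp (T : finType) (D E : {set T}) (d N : nat) :
    E \subset D -> #|D| = d.+1 -> (#|E| <= N)%N ->
  #|[set c : {ffun T -> 'I_N.+1} |
      [&& (\sum_x c x == N)%N, [forall x, (0 < c x)%N ==> (x \in D)]
        & [forall x in E, (0 < c x)%N]]]| = 'C(d + (N - #|E|), d).
Proof.
move=> sED cD leEN.
set K := (N - #|E|)%N.
have cD' : #|{: {x | x \in D}}| = d.+1 by rewrite card_sig -cD; apply: eq_card.
rewrite -(card_ffun_sum K cD').
set A := [set c : {ffun {x | x \in D} -> 'I_K.+1} | _].
(* The inverse map: extend by 0 outside [D], then give the unit back to each point of [E]. *)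
pose v (t : {ffun {x | x \in D} -> 'I_K.+1}) x : nat :=
  (oapp (fun y => t y : nat) 0 (insub x) + (x \in E))%N.
pose g t : {ffun T -> 'I_N.+1} := [ffun x => inord (v t x)].
have sumD (F : T -> nat) :
    (\sum_(x in D) F x = \sum_(y : {x | x \in D}) F (val y))%N.
  rewrite (reindex_omap (val : {x | x \in D} -> T) insub) /=; last first.
    by move=> x xD; rewrite insubT.
  by apply: eq_bigl => -[x xD] /=; rewrite xD /= insubT /= eqxx.
have sumE : (\sum_x (x \in E) = #|E|)%N.
  by rewrite -sum1_card [RHS]big_mkcond; apply: eq_bigr => x _; case: (x \in E).
have sumv t : (\sum_x v t x = \sum_y t y + #|E|)%N.
  rewrite /v big_split /= sumE (bigID [in D]) /= sumD.
  rewrite [X in (_ + X + _)%N]big1 ?addn0; last first.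
    by move=> x xD; rewrite insubF //; apply: negbTE.
  by congr (_ + _)%N; apply: eq_bigr => y _; rewrite valK.
have vN t x : t \in A -> (v t x < N.+1)%N.
  rewrite inE => /eqP tK; rewrite ltnS.
  have := sumv t; rewrite tK subnK // => <-.
  by rewrite (bigD1 x) //= leq_addr.
have gE t x : t \in A -> g t x = v t x :> nat.
  by move=> tA; rewrite ffunE inordK // vN.
have ginj : {in A &, injective g}.
  move=> t t' tA t'A /ffunP e; apply/ffunP => y; apply: val_inj => /=.
  have := congr1 val (e (val y)); rewrite /= !gE // /v valK /=.
  by move/addIn.
rewrite -(card_in_imset ginj); apply: eq_card => c; apply/idP/imsetP.
  rewrite inE => /and3P[/eqP cN /forallP cD1 /forall_inP cE1].
  pose t : {ffun {x | x \in D} -> 'I_K.+1} :=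
    [ffun y => inord (c (val y) - (val y \in E))].
  have sumt : (\sum_(y : {x | x \in D}) (c (val y) - (val y \in E)) = K)%N.
    rewrite /K -[X in (_ = X - _)%N]cN -sumE -sumnB; last by move=> x _; case xE: (x \in E); rewrite ?cE1.
    rewrite -(sumD (fun x => c x - (x \in E))%N) [RHS](bigID [in D]) /=.
    rewrite [X in (_ + X)%N]big1 ?addn0 // => x xD.
    by have := cD1 x; rewrite (negbTE xD) implybF; lia.
  have tE y : t y = (c (val y) - (val y \in E))%N :> nat.
    rewrite ffunE inordK // ltnS -sumt (bigD1 y) //= leq_addr //.
  have tA : t \in A.
    by rewrite inE; apply/eqP; rewrite -[RHS]sumt; apply: eq_bigr => y _.
  exists t => //; apply/ffunP => x; apply: val_inj; rewrite /= gE // /v.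
  case: insubP => [y yD <-|xD] /=.
    by rewrite tE subnK //; case yE: (_ \in E); rewrite // cE1.
  have := cD1 x; rewrite (negbTE xD) implybF => /negbTE.
  have -> : x \in E = false by apply: contraNF xD => /(fintype.subsetP sED).
  by lia.
case=> t tA ->; rewrite inE; apply/and3P; split.
- under eq_bigr do rewrite gE //.
  by rewrite sumv; move: tA; rewrite inE => /eqP ->; rewrite subnK.
- apply/forallP => x; apply/implyP; rewrite gE // /v.
  case: insubP => //= xD; have -> // : x \in E = false.
  by apply: contraNF xD => /(fintype.subsetP sED).
- by apply/forall_inP => x xE; rewrite gE // /v xE addn1.
Qed.

(** Multiplied by [n! k! (a - k)!], both sides become [(a + n)!]. *)
Lemma trinomial_revision a k n :
  (n + k <= a + n)%N -> ('C(a + n, n + k) * 'C(n + k, n) = 'C(a + n, n) * 'C(a, k))%N.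
Proof.
move=> h; have ka : (k <= a)%N by lia.
have e1 := bin_fact h; have e2 : ('C(n + k, n) * (n`! * (n + k - n)`!) = (n + k)`!)%N.
  by apply: bin_fact; lia.
have e3 : ('C(a + n, n) * (n`! * (a + n - n)`!) = (a + n)`!)%N by apply: bin_fact; lia.
have e4 := bin_fact ka.
have E1 : (n + k - n = k)%N by lia.
have E2 : (a + n - n = a)%N by lia.
have E3 : (a + n - (n + k) = a - k)%N by lia.
rewrite E1 in e2; rewrite E2 in e3; rewrite E3 in e1.
apply/eqP; rewrite -(eqn_pmul2r (_ : 0 < n`! * k`! * (a - k)`!)%N) ?muln_gt0 ?fact_gt0 //.
apply/eqP; transitivity (a + n)`!.
  by rewrite -e1 -e2; ring.
by rewrite -e3 -e4; ring.
Qed.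

(** Trinomial revision pulls ['C(N + n, n)] out of the sum; Vandermonde evaluates the rest to the
    same number. *)
Lemma sum_bin_square n N :
  (\sum_(k < N.+1) ('C(n, k) * 'C(n + k, n)) * 'C(N + n, n + k) = 'C(N + n, n) ^ 2)%N.
Proof.
transitivity ('C(N + n, n) * \sum_(k < N.+1) 'C(n, k) * 'C(N, N - k))%N.
  rewrite big_distrr /=; apply: eq_bigr => -[k /= kN] _.
  rewrite bin_sub // -mulnA [X in (_ * X)%N]mulnC trinomial_revision; last by lia.
  by rewrite mulnCA.
have -> : (\sum_(k < N.+1) 'C(n, k) * 'C(N, N - k) = 'C(n + N, N))%N.
  exact: binomial.Vandermonde.
by rewrite [(n + N)%N]addnC -[X in (_ * X)%N](bin_sub (leq_addr n N)) addKn mulnn.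
Qed.

(* The relations form a unitriangular system in [f]. *)
Lemma bin_square_unique n (f : nat -> nat) :
    (forall N, \sum_(k < N.+1) f k * 'C(N + n, n + k) = 'C(N + n, n) ^ 2)%N ->
  forall m, f m = ('C(n, m) * 'C(n + m, n))%N.
Proof.
move=> fE m; elim/ltn_ind: m => m IH.
have := fE m; rewrite -sum_bin_square !big_ord_recr /= [(m + n)%N]addnC binn !muln1.
rewrite (eq_bigr (fun k : 'I_m => 'C(n, k) * 'C(n + k, n) * 'C(n + m, n + k))%N).
  by move/addnI.
by move=> k _; rewrite IH.
Qed.

(** * Integral transport plans *)

Section Transport.
Local Open Scope ring_scope.
Context (R : realType) (X : finType) (rho : X -> X -> R).
Implicit Types (f : X -> R) (c : X -> X -> nat) (E : {set X * X}).

Definition lipschitz f := forall x y, f x - f y <= rho x y.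

Definition tight f : {set X * X} :=
  [set e | (e.1 != e.2) && (f e.1 - f e.2 == rho e.1 e.2)].

(** Complementary slackness: [f] is a feasible dual potential for the plan [c]. *)
Definition compatible c f :=
  lipschitz f /\ forall x y, (0 < c x y)%N -> f x - f y = rho x y.

(** Arcs of the residual network: a unit may be added on a tight pair, or cancelled against mass
    sent the opposite way. *)
Definition residual c f : rel X :=
  [rel x y | (f x - f y == rho x y) || (0 < c y x)%N].

Definition net c z : int := \sum_y (c z y)%:Z - \sum_y (c y z)%:Z.

(* The dual step of the Hungarian method: raise [f] on the set reachable from
   [a] until a new arc becomes tight. *)
Lemma connect_residual c f a b : compatible c f ->
  exists2 f', compatible c f' & connect (residual c f') a b.
Proof.
(* Induction on the number of points not yet reached from [a]. *)
have [k] := ubnP (#|X| - #|connect (residual c f) a|)%N.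
elim: k f => // k IH f; rewrite ltnS => lek cf.
have [ab|nab] := boolP (connect (residual c f) a b); first by exists f.
pose S := connect (residual c f) a.
pose sl (e : X * X) := rho e.1 e.2 - (f e.1 - f e.2).
pose P (e : X * X) := S e.1 && ~~ S e.2.
have Pab : P (a, b) by rewrite /P /= nab andbT; apply: connect0.
(* The least slack among pairs leaving [S] is attained at [(p, q)]; raising [f] by it on [S] keeps
   [f] Lipschitz and makes [(p, q)] tight. *)
case: (Order.TotalTheory.arg_minP sl Pab) => -[p q]; rewrite /P /= => /andP[Sp Sq] slmin.
set eps := sl (p, q) in slmin.
have eps0 : 0 < eps.
  rewrite /eps /sl /= lt_neqAle subr_ge0 cf.1 andbT eq_sym subr_eq0.
  apply: contraNneq Sq => e; apply: (connect_trans Sp); apply: connect1.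
  by rewrite /residual /= e eqxx.
pose f' x := f x + (if S x then eps else 0).
have f'in x y : S x = S y -> f' x - f' y = f x - f y.
  by rewrite /f' => ->; lra.
have cf' : compatible c f'.
  split=> x y.
    have lfxy := cf.1 x y.
    have [Sxy|] := eqVneq (S x) (S y); first by rewrite f'in.
    rewrite /f'; case Sx: (S x); case Sy: (S y) => // _; last by lra.
    have := slmin (x, y); rewrite /P /= Sx Sy => /(_ isT).
    by rewrite /sl /=; lra.
  (* A pair carrying mass can be traversed in both directions, so its ends lie on the same side of
     [S]. *)
  move=> cxy; have fxy := cf.2 _ _ cxy.
  rewrite f'in // /S; apply/idP/idP => [ax|ay].
    by apply: connect_trans ax (connect1 _); rewrite /residual /= fxy eqxx.
  by apply: connect_trans ay (connect1 _); rewrite /residual /= cxy orbT.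
have SS' x : S x -> connect (residual c f') a x.
  case/connectP => s; elim/last_ind: s x => [|s y IHs] x /=.
    by move=> _ ->; apply: connect0.
  rewrite rcons_path last_rcons => /andP[pas ry] ->.
  have Sl : S (last a s) by apply/connectP; exists s.
  have Sy : S y by apply: connect_trans Sl (connect1 ry).
  apply: (connect_trans (IHs _ pas erefl)); apply: connect1.
  by move: ry; rewrite /residual /= f'in // Sl Sy.
have S'q : connect (residual c f') a q.
  apply: connect_trans (SS' _ Sp) (connect1 _); apply/orP; left.
  by rewrite /f' Sp (negbTE Sq) /eps /sl /=; apply/eqP; lra.
apply: (IH f' _ cf'); apply: leq_trans lek; apply: ltn_sub2l.
  rewrite -(cardC (connect (residual c f) a)) -[ltnLHS]addn0 ltn_add2l.
  by apply/card_gt0P; exists b.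
apply: proper_card; apply/properP; split; first by apply/fintype.subsetP => x; exact: SS'.
by exists q.
Qed.

Lemma net_add c c' x y (d : int) :
    (forall i j, (c' i j)%:Z = (c i j)%:Z + d *+ ((i == x) && (j == y))) ->
  forall z, net c' z = net c z + d *+ (z == x) - d *+ (z == y).
Proof.
move=> cE z; rewrite /net.
under eq_bigr do rewrite cE; rewrite big_split /=.
under [X in _ - X = _]eq_bigr do rewrite cE; rewrite big_split /=.
have -> : \sum_j d *+ ((z == x) && (j == y)) = d *+ (z == x).
  rewrite (bigD1 y) //= eqxx andbT big1 ?addr0 // => j jy.
  by rewrite (negbTE jy) andbF.
have -> : \sum_j d *+ ((j == x) && (z == y)) = d *+ (z == y).
  rewrite (bigD1 x) //= eqxx big1 ?addr0 // => j jx.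
  by rewrite (negbTE jx).
by rewrite opprD addrACA addrA.
Qed.

(** The last clause confines the change to entries meeting [x], so that the rest of a simple path
    starting at [x] stays traversable. *)
Lemma push_arc c f x y : compatible c f -> residual c f x y ->
  exists c', [/\ compatible c' f, forall z, net c' z = net c z + (z == x)%:Z - (z == y)%:Z
    & forall i j, i != x -> j != x -> c' i j = c i j].
Proof.
move=> cf; rewrite /residual /=; have [cyx _|cyx] := ltnP 0%N (c y x).
  exists (fun i j => c i j - ((i == y) && (j == x)))%N; split.
  - by split=> [|i j ij]; [exact: cf.1 | apply: cf.2; apply: leq_trans ij (leq_subr _ _)].
  - move=> z; rewrite (net_add (x := y) (y := x) (d := -1) (c := c)); first by lia.
    by move=> i j; case: eqP => [->|_]; case: eqP => [->|_] /=; lia.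
  - by move=> i j _ /negbTE ->; rewrite andbF subn0.
rewrite orbF => /eqP fxy; exists (fun i j => c i j + ((i == x) && (j == y)))%N; split.
- split=> [|i j ij]; first exact: cf.1.
  case/boolP: ((i == x) && (j == y)) ij => [/andP[/eqP-> /eqP->] //|_].
  by rewrite addn0; apply: cf.2.
- move=> z; rewrite (net_add (x := x) (y := y) (d := 1) (c := c)); first by lia.
  by move=> i j; lia.
- by move=> i j /negbTE ->; rewrite addn0.
Qed.

Lemma push_path c f a b : compatible c f -> connect (residual c f) a b ->
  exists2 c', compatible c' f & forall z, net c' z = net c z + (z == a)%:Z - (z == b)%:Z.
Proof.
(* The path is made simple: pushing along its first arc alters only entries at the starting point,
   to which the path never returns. *)
move=> cf /connectP[p /shortenP[p' pp' up' _] {p}->].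
elim: p' a c cf pp' up' => [|x p IH] a c cf.
  by move=> _ _; exists c => // z /=; lia.
rewrite [path _ _ _]/= [uniq _]/= => /andP[rax pxp] /andP[axp uxp].
have [c1 [cf1 n1 e1]] := push_arc cf rax.
have pxp1 : path (residual c1 f) x p.
  apply: (sub_in_path (P := predC1 a)) pxp.
    move=> y z /= ya za; rewrite /residual /= -!topredE /= in ya za *.
    by rewrite e1.
  by apply/allP => z zp; apply: contraNneq axp => <-.
have [c2 cf2 n2] := IH _ _ cf1 pxp1 uxp.
by exists c2 => // z; rewrite n2 n1 /=; lia.
Qed.

Hypothesis rho_metric : is_metric rho.

(** Induction on the mass: drop one unit of [u] at [a] and one of [v] at [b], change the potential
    until [b] is reachable from [a], and push one unit along the path. Only net flows are
    prescribed; the diagonal is settled later. *)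
Lemma transport_exists N (u v : X -> nat) :
    (\sum_x u x = N)%N -> (\sum_x v x = N)%N ->
  exists c f, compatible c f /\ forall z, net c z = (u z)%:Z - (v z)%:Z.
Proof.
elim: N u v => [|N IH] u v uN vN.
  exists (fun _ _ => 0%N), (fun _ => 0); split.
    by split=> // x y; rewrite subrr; case: rho_metric.
  move/eqP: uN; move/eqP: vN; rewrite !sum_nat_eq0 => /forallP v0 /forallP u0 z.
  by rewrite (eqP (u0 z)) (eqP (v0 z)) /net !big1.
have pick1 (w : X -> nat) : (\sum_x w x = N.+1)%N ->
    exists2 a, (0 < w a)%N & (\sum_x (w x - (x == a)) = N)%N.
  move=> wN; have [a wa] : exists a, (0 < w a)%N.
    apply/existsP; apply: contraPT wN => /existsPn w0.
    by rewrite big1 // => x _; have := w0 x; lia.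
  exists a => //; rewrite (bigD1 a) //= eqxx.
  move: wN; rewrite (bigD1 a) //= => wN.
  rewrite (eq_bigr w) => [|x /negbTE ->]; last by rewrite subn0.
  by move: wN; lia.
have [a ua ua'] := pick1 u uN; have [b vb vb'] := pick1 v vN.
have [c [f [cf nc]]] := IH _ _ ua' vb'.
have [f' cf' ab] := connect_residual a b cf.
have [c' cf'' nc'] := push_path cf' ab.
exists c', f'; split=> // z; rewrite nc' nc.
have : ((z == a) <= u z)%N by case: eqP => // ->.
have : ((z == b) <= v z)%N by case: eqP => // ->.
by case: (z == a); case: (z == b) => /=; lia.
Qed.

End Transport.

(** * Counting admissible sets *)

Section Counting.
Local Open Scope ring_scope.
Context (R : realType) (X : finType) (rho : X -> X -> R).
Implicit Types (f g h : X -> R) (E : {set X * X}).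

Definition independent E := forall w : X * X -> R,
  (forall z, \sum_(e in E) w e * ((z == e.1)%:R - (z == e.2)%:R) = 0) ->
  forall e, e \in E -> w e = 0.

Definition admissible E : bool :=
  `[< exists2 f, lipschitz rho f & tight rho f = E >].

(** Independent rows give the incidence matrix a right inverse; applying it to [t] produces [h]. *)
Lemma independent_prescribe E : independent E -> forall t : X * X -> R,
  exists h, forall e, e \in E -> h e.1 - h e.2 = t e.
Proof.
move=> iE t.
pose M := \matrix_(i < #|E|, j < #|X|)
  (((enum_val j == (enum_val i).1)%:R - (enum_val j == (enum_val i).2)%:R) : R).
have : row_free M.
  rewrite -kermx_eq0; apply/rowV0P => w /sub_kermxP wM.
  pose W e := if insub e is Some ei then w 0 (enum_rank_in (valP ei) (val (ei : {e | e \in E}))) else 0.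
  have WE i : W (enum_val i) = w 0 i.
    rewrite /W; case: insubP => [[e eE] _ /= ee|/negP[]]; last exact: enum_valP.
    by congr (w 0 _); apply: enum_val_inj; rewrite enum_rankK_in.
  have W0 : forall e, e \in E -> W e = 0.
    apply: iE => z; have := congr1 (fun A : 'M_(_, _) => A 0 (enum_rank z)) wM.
    rewrite !mxE => wMz; rewrite -[RHS]wMz big_enum_val; apply: eq_bigr => i _.
    by rewrite WE mxE enum_rankK.
  by apply/rowP => i; rewrite -WE W0 ?enum_valP // mxE.
case/row_freeP => B MB.

exists (fun x => (B *m \col_i t (enum_val i)) (enum_rank x) 0) => e eE.
have := congr1 (fun A : 'cV_(_) => A (enum_rank_in eE e) 0) (mulmxA M B (\col_i t (enum_val i))).
rewrite MB mul1mx [in RHS]mxE enum_rankK_in // => <-.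
move: (B *m _) => b; rewrite [RHS]mxE.
rewrite (reindex (@enum_rank X)) /=; last by apply: onW_bij; apply: enum_rank_bij.
under [RHS]eq_bigr do rewrite mxE !enum_rankK enum_rankK_in // mulrBl.
rewrite sumrB; congr (_ - _).
  rewrite (bigD1 e.1) //= eqxx mul1r big1 ?addr0 // => i /negbTE -> .
  by rewrite mul0r.
rewrite (bigD1 e.2) //= eqxx mul1r big1 ?addr0 // => i /negbTE -> .
by rewrite mul0r.
Qed.

Lemma small_multiplier (T : finType) (a s : T -> R) :
  exists2 eps : R, 0 < eps & forall e, 0 < s e -> eps * a e < s e.
Proof.
suff [eps eps0 epsE] : exists2 eps : R, 0 < eps &
    forall e, e \in enum T -> 0 < s e -> eps * `|a e| < s e.
  exists eps => // e se; apply: le_lt_trans (epsE e _ se); last by rewrite mem_enum.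
  by rewrite ler_pM2l // ler_norm.
elim: (enum T) => [|e l [eps eps0 IH]]; first by exists 1.
have [se|se] := ltP 0 (s e); last first.
  exists eps => // e'; rewrite inE => /orP[/eqP->|]; last exact: IH.
  by move=> /(le_lt_trans se); rewrite ltxx.
have a1 : 0 < 1 + `|a e| by rewrite ltr_pwDl.
(* Adding 1 to the denominator avoids division by zero and makes the bound strict. *)
exists (Num.min eps (s e / (1 + `|a e|))); first by rewrite lt_min eps0 divr_gt0.
move=> e'; rewrite inE => /orP[/eqP->|e'l] se'.
  apply: (@le_lt_trans _ _ (s e / (1 + `|a e|) * `|a e|)).
    by rewrite ler_wpM2r // ge_min lexx orbT.
  by rewrite mulrAC ltr_pdivrMr // ltr_pM2l // ltrDr.
apply: le_lt_trans (IH _ e'l se').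
by rewrite ler_wpM2r // ge_min lexx.
Qed.

(** For small [eps] loose pairs keep positive slack, while on tight pairs the difference cannot
    grow; it is unchanged exactly when [h] agrees at both ends. *)
Lemma lipschitz_perturb f h : lipschitz rho f ->
    (forall e, e \in tight rho f -> h e.1 <= h e.2) ->
  exists2 eps : R, 0 < eps &
    lipschitz rho (fun x => f x + eps * h x) /\
    tight rho (fun x => f x + eps * h x) = [set e in tight rho f | h e.1 == h e.2].
Proof.
move=> lf hT.
have [eps eps0 epsE] := small_multiplier (fun e : X * X => h e.1 - h e.2)
  (fun e => rho e.1 e.2 - (f e.1 - f e.2)).
have slackE x y : f x + eps * h x - (f y + eps * h y) = (f x - f y) + eps * (h x - h y).
  by ring.
have loose x y : x != y -> (x, y) \notin tight rho f ->
    f x + eps * h x - (f y + eps * h y) < rho x y.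
  move=> xy; rewrite inE /= xy /= => nxy.
  have := epsE (x, y); rewrite /= subr_gt0 lt_neqAle nxy lf => /(_ isT).
  by rewrite slackE; lra.
exists eps => //; split.
  move=> x y; have [->|xy] := eqVneq x y.
    by have := lf y y; rewrite !subrr.
  case: (boolP ((x, y) \in tight rho f)) => [Txy|/loose/ltW]; last by apply.
  rewrite slackE; have /= := hT _ Txy; rewrite -subr_le0 => hxy.
  have : eps * (h x - h y) <= 0 by rewrite pmulr_rle0.
  by have := lf x y; lra.
apply/setP => -[x y]; rewrite 2!inE /=.
case xy: (x != y); last by rewrite inE /= xy.
case Txy: ((x, y) \in tight rho f) => /=; last first.
  by apply/negbTE; rewrite lt_eqF // loose // Txy.
move: Txy; rewrite inE /= xy => /eqP <-.
by rewrite slackE addrC -subr_eq0 addrK mulf_eq0 (gt_eqF eps0) subr_eq0.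
Qed.

Hypothesis tight_independent : forall f, lipschitz rho f -> independent (tight rho f).

(** Perturbing along some [h] with difference 0 on [E'] and -1 on the rest of [E] loosens exactly
    the unwanted pairs. *)
Lemma admissible_sub E E' : admissible E -> E' \subset E -> admissible E'.
Proof.
move=> /asboolP[f lf <-] sE; apply/asboolP.
have [h hE] := independent_prescribe (tight_independent lf) (fun e => - (e \notin E')%:R).
have [e eT|eps eps0 [lg tg]] := lipschitz_perturb (h := h) lf.
  by rewrite -subr_le0 hE // oppr_le0 ler0n.
exists (fun x => f x + eps * h x) => //; rewrite tg; apply/setP => e; rewrite inE.
apply/andP/idP => [[eT]|eE'].
  by rewrite -subr_eq0 hE // oppr_eq0; case: (e \in E') => //=; rewrite oner_eq0.
by have eT := fintype.subsetP sE _ eE'; rewrite -subr_eq0 hE // eE' /= oppr0.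
Qed.

Hypothesis rho_metric : is_metric rho.
Hypothesis rho_strict : strict_metric rho.

(** Along consecutive tight pairs the differences of [f] add up to [rho x y + rho y z], which
    strictness puts above [rho x z]. *)
Lemma tight_head_tail f x y z : lipschitz rho f ->
  (x, y) \in tight rho f -> (y, z) \in tight rho f -> False.
Proof.
move=> lf; rewrite !inE /= => /andP[xy /eqP fxy] /andP[yz /eqP fyz].
have := @rho_strict x y z; rewrite eq_sym xy => /(_ isT yz).
by have := lf x z; lra.
Qed.

(** * Plans and their marginals *)

Definition off_supp (N : nat) (c : {ffun X * X -> 'I_N.+1}) : {set X * X} :=
  [set e | (e.1 != e.2) && (0 < c e)%N].

Definition plans (N : nat) : {set {ffun X * X -> 'I_N.+1}} :=
  [set c : {ffun X * X -> 'I_N.+1} | (\sum_e c e == N)%N && admissible (off_supp c)].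

(** [inord] does not truncate for plans of mass [N], whose row and column sums are at most [N]. *)
Definition marginals (N : nat) (c : {ffun X * X -> 'I_N.+1}) :
    {ffun X -> 'I_N.+1} * {ffun X -> 'I_N.+1} :=
  ([ffun x => inord (\sum_y c (x, y))], [ffun y => inord (\sum_x c (x, y))]).

Lemma sum_pair (V : nmodType) (F : X * X -> V) :
  \sum_e F e = \sum_x \sum_y F (x, y).
Proof. by rewrite pair_bigA; apply: eq_bigr => -[]. Qed.

Lemma row_le (N : nat) (c : {ffun X * X -> 'I_N.+1}) x :
  (\sum_e c e = N)%N -> (\sum_y c (x, y) < N.+1)%N.
Proof.
move=> cN; rewrite ltnS -[leqRHS]cN (sum_pair (fun e => c e : nat)).
by rewrite [leqRHS](bigD1 x) //= leq_addr.
Qed.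

Lemma col_le (N : nat) (c : {ffun X * X -> 'I_N.+1}) y :
  (\sum_e c e = N)%N -> (\sum_x c (x, y) < N.+1)%N.
Proof.
move=> cN; rewrite ltnS -[leqRHS]cN (sum_pair (fun e => c e : nat)).
by rewrite exchange_big /= [leqRHS](bigD1 y) //= leq_addr.
Qed.

Lemma sum_marginals (c : X * X -> nat) g h :
  \sum_e (c e)%:R * (g e.1 - h e.2) =
  \sum_x (\sum_y c (x, y))%N%:R * g x - \sum_y (\sum_x c (x, y))%N%:R * h y.
Proof.
under eq_bigr do rewrite mulrBr.
rewrite sumrB !sum_pair /=; congr (_ - _).
  by apply: eq_bigr => x _; rewrite natr_sum mulr_suml.
rewrite exchange_big; apply: eq_bigr => y _.
by rewrite natr_sum mulr_suml.
Qed.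

(** Potentials certify that both plans are optimal for their common marginals. Hence the potential
    of [c] is also tight on the off-diagonal support of [c'], and [c - c'] gives a relation among
    independent vectors. *)
Lemma marginals_inj N : {in plans N &, injective (@marginals N)}.
Proof.
move=> c c'; rewrite !inE => /andP[/eqP cN /asboolP[f lf fT]] /andP[/eqP c'N /asboolP[f' lf' f'T]].
case=> /ffunP rows /ffunP cols.
have row x : (\sum_y c (x, y) = \sum_y c' (x, y))%N.
  by have := congr1 val (rows x); rewrite !ffunE /= !inordK // row_le.
have col y : (\sum_x c (x, y) = \sum_x c' (x, y))%N.
  by have := congr1 val (cols y); rewrite !ffunE /= !inordK // col_le.
have sumE g : \sum_e (c e)%:R * (g e.1 - g e.2) = \sum_e (c' e)%:R * (g e.1 - g e.2).
  rewrite (sum_marginals (fun e => c e : nat)) (sum_marginals (fun e => c' e : nat)).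
  by congr (_ - _); apply: eq_bigr => x _; rewrite ?row ?col.
pose slack g (d : {ffun X * X -> 'I_N.+1}) : R := \sum_e (d e)%:R * (rho e.1 e.2 - (g e.1 - g e.2)).
have slack_ge0 g d : lipschitz rho g -> 0 <= slack g d.
  by move=> lg; apply: sumr_ge0 => e _; rewrite mulr_ge0 // subr_ge0.
have slack0 g d : tight rho g = off_supp d -> slack g d = 0.
  move=> gT; apply: big1 => -[x y] _ /=.
  have [->|xy] := eqVneq x y.
    case: rho_metric => _ /(_ y y) [_ /(_ erefl) ->] _ _.
    by rewrite subrr subr0 mulr0.
  case: (posnP (d (x, y))) => [->|dxy]; first by rewrite mul0r.
  have : (x, y) \in off_supp d by rewrite inE xy.
  by rewrite -gT inE /= => /andP[_ /eqP->]; rewrite subrr mulr0.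
have slackB g d : slack g d = \sum_e (d e)%:R * rho e.1 e.2 - \sum_e (d e)%:R * (g e.1 - g e.2).
  by rewrite -sumrB; apply: eq_bigr => e _; rewrite mulrBr.
(* Weak duality for [f'] against [c] bounds the cost of [c'] by that of [c], so the slack of [f] on
   [c'] is at most 0. *)
have slackc' : slack f c' = 0.
  apply/eqP; rewrite eq_le slack_ge0 // andbT.
  have := slack_ge0 f' c lf'; have := slack0 _ _ fT; have := slack0 _ _ f'T.
  by rewrite !slackB !sumE; lra.
have supp' : {subset off_supp c' <= off_supp c}.
  move=> e; rewrite -fT !inE => /andP[ne c'e]; rewrite ne /=.
  have /(_ e isT) : forall e, true -> (c' e)%:R * (rho e.1 e.2 - (f e.1 - f e.2)) = 0.
    apply: psumr_eq0P slackc' => e' _.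
    by rewrite mulr_ge0 // subr_ge0.
  move/eqP; rewrite mulf_eq0 pnatr_eq0 (gtn_eqF c'e) /= subr_eq0 => /eqP ->.
  exact: eqxx.
have offE e : e.1 != e.2 -> c e = c' e.
  move=> ne; apply: val_inj => /=.
  case: (boolP (e \in off_supp c)) => [eT|eT]; last first.
    have := contra (supp' e) eT; move: eT; rewrite !inE ne /= -!leqNgt !leqn0.
    by move=> /eqP -> /eqP ->.
  have : (c e)%:R - (c' e)%:R = 0 :> R.
    have iT := tight_independent lf; rewrite fT in iT.
    apply: (iT (fun e => (c e)%:R - (c' e)%:R)) => // z.
    rewrite big_mkcond /= -[RHS](subrr (\sum_e (c e)%:R * ((z == e.1)%:R - (z == e.2)%:R))).
    rewrite [X in _ = _ - X](sumE (fun x => (z == x)%:R)) -sumrB.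
    apply: eq_bigr => e' _; rewrite -mulrBl.
    case: ifPn => // e'T; case: (eqVneq e'.1 e'.2) => [->|ne']; first by rewrite subrr mulr0.
    have := contra (supp' e') e'T; move: e'T; rewrite !inE ne' /= -!leqNgt !leqn0.
    by move=> /eqP -> /eqP ->; rewrite subrr mul0r.
  by move/eqP; rewrite subr_eq0 eqr_nat => /eqP.
(* The diagonal entries follow from equal row sums. *)
apply/ffunP => -[x y]; have [<-|xy] := eqVneq x y; last exact: offE.
apply: val_inj => /=; have := row x.
rewrite (bigD1 x) //= [in RHS](bigD1 x) //=.
rewrite (eq_bigr (fun y => c' (x, y) : nat)); first by move/addIn.
by move=> z zx; rewrite offE //= eq_sym.
Qed.

(** A compatible flow supplies the off-diagonal entries. By strictness no point both sends and
    receives mass off the diagonal, so [x] sends at most [u x], and the remainder is placed at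
    [(x, x)]. *)
Lemma marginals_onto N (u v : {ffun X -> 'I_N.+1}) :
    (\sum_x u x = N)%N -> (\sum_x v x = N)%N ->
  exists2 c, c \in plans N & marginals c = (u, v).
Proof.
move=> uN vN.
have [c0 [f [[lf cf] nc]]] := transport_exists rho_metric uN vN.
pose out x := (\sum_(y | y != x) c0 x y)%N.
pose inn x := (\sum_(y | y != x) c0 y x)%N.
have ncE z : (u z + inn z = v z + out z)%N.
  have sumZ (F : X -> nat) : \sum_(y | y != z) (F y)%:Z = (\sum_(y | y != z) F y)%N%:Z.
    by rewrite (big_morph Posz PoszD (erefl _)).
  by have := nc z; rewrite /net (bigD1 z) //= [X in _ - X](bigD1 z) //= !sumZ /inn /out; lia.
have tightE x y : x != y -> (0 < c0 x y)%N -> (x, y) \in tight rho f.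
  by move=> xy cxy; rewrite inE /= xy cf ?eqxx.
have inn_out z : (inn z = 0 \/ out z = 0)%N.
  have [->|] := posnP (inn z); first by left.
  have [->|] := posnP (out z); first by right.
  rewrite !lt0n !sum_nat_eq0 => /forall_inPn[y yz cy] /forall_inPn[x xz cx].
  case: (@tight_head_tail f x z y lf); apply: tightE; rewrite ?lt0n //.
  by rewrite eq_sym.
have out_le x : (out x <= u x)%N by have := ncE x; case: (inn_out x); lia.
pose c1 e := if e.1 == e.2 then (u e.1 - out e.1)%N else c0 e.1 e.2.
have row x : (\sum_y c1 (x, y) = u x)%N.
  rewrite (bigD1 x) //= {1}/c1 /= eqxx (eq_bigr (fun y => c0 x y)) ?subnK //.
  by move=> y; rewrite /c1 /= eq_sym => /negbTE ->.
have col x : (\sum_y c1 (y, x) = v x)%N.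
  rewrite (bigD1 x) //= {1}/c1 /= eqxx (eq_bigr (fun y => c0 y x)).
    by rewrite -/(inn x); have := ncE x; have := out_le x; lia.
  by move=> y; rewrite /c1 /= => /negbTE ->.
have c1N : (\sum_e c1 e = N)%N.
  by rewrite (sum_pair c1) -[RHS]uN; apply: eq_bigr => x _; rewrite row.
have c1_le e : (c1 e < N.+1)%N by rewrite ltnS -[leqRHS]c1N (bigD1 e) //= leq_addr.
exists [ffun e => inord (c1 e)].
  rewrite inE; apply/andP; split.
    by under eq_bigr do rewrite ffunE inordK //; rewrite c1N.
  apply: (@admissible_sub (tight rho f)); first by apply/asboolP; exists f.
  apply/fintype.subsetP => -[x y]; rewrite inE /= ffunE inordK // => /andP[xy].
  by rewrite /c1 /= (negbTE xy) => /(tightE _ _ xy).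
congr (_, _); apply/ffunP => x; rewrite ffunE; apply: val_inj => /=.
  by under eq_bigr do rewrite ffunE inordK //; rewrite row inordK.
by under eq_bigr do rewrite ffunE inordK //; rewrite col inordK.
Qed.

Lemma card_plans n N : #|X| = n.+1 -> #|plans N| = ('C(N + n, n) ^ 2)%N.
Proof.
move=> cX; rewrite -(card_in_imset (@marginals_inj N)).
pose S := [set u : {ffun X -> 'I_N.+1} | (\sum_x u x == N)%N].
have -> : @marginals N @: plans N = finset.setX S S.
  apply/setP => -[u v]; rewrite finset.in_setX !inE; apply/imsetP/andP => [[c]|[/eqP uN /eqP vN]].
    rewrite inE => /andP[/eqP cN _] [-> ->].
    have cN' := cN; rewrite (sum_pair (fun e => c e : nat)) in cN'.
    split; apply/eqP; rewrite -[RHS]cN'; last rewrite exchange_big /=.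
      by apply: eq_bigr => x _; rewrite ffunE inordK // row_le.
    by apply: eq_bigr => x _; rewrite ffunE inordK // col_le.
  by have [c cP cE] := marginals_onto uN vN; exists c.
by rewrite cardsX (card_ffun_sum N cX) addnC mulnn.
Qed.

Lemma admissible_offdiag E x : admissible E -> (x, x) \notin E.
Proof. by move=> /asboolP[f _ <-]; rewrite inE /= eqxx. Qed.

(** Such a plan is positive on [E] and vanishes outside [E] and the diagonal, which together have
    [n + 1 + #|E|] pairs. If [#|E| > N] there is none, and the binomial is 0. *)
Lemma card_off_supp n N E : #|X| = n.+1 -> admissible E ->
  #|[set c : {ffun X * X -> 'I_N.+1} | (\sum_e c e == N)%N && (off_supp c == E)]|
    = 'C(N + n, n + #|E|).
Proof.
move=> cX aE.
pose diag := [set (x, x) | x : X].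
have [EN|EN] := leqP #|E| N; last first.
  rewrite bin_small; last by lia.
  apply: eq_card0 => c; rewrite inE; apply: contraTF EN => /andP[/eqP cN /eqP <-].
  rewrite -leqNgt -[leqRHS]cN -sum1_card [leqRHS](bigID [in off_supp c]) /=.
  apply: leq_trans (leq_addr _ _); apply: leq_sum => e.
  by rewrite inE => /andP[].
have cD : #|finset.setU diag E| = (n + #|E|).+1.
  rewrite cardsU disjoint_setI0 ?cards0 ?subn0.
    rewrite card_imset ?cX ?addSn // => x y [].
    by [].
  rewrite -setI_eq0; apply/eqP/setP => -[x y]; rewrite finset.in_setI finset.in_set0.
  apply/negbTE/andP => -[/imsetP[z _ [-> ->]]]; apply/negP.
  exact: admissible_offdiag.
have -> : (N + n = n + #|E| + (N - #|E|))%N by lia.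
rewrite -(card_ffun_sum_supp (finset.subsetUr diag E) cD EN).
apply: eq_card => c; rewrite !inE; congr (_ && _).
apply/eqP/andP => [cE|[/forallP cD1 /forall_inP cE]].
  split; last by apply/forall_inP => e; rewrite -cE inE => /andP[].
  apply/forallP => -[x y]; apply/implyP => cxy; rewrite finset.in_setU.
  have [->|xy] := eqVneq x y; first by rewrite imset_f.
  by rewrite -cE [X in _ || X]inE /= xy cxy orbT.
apply/setP => -[x y]; rewrite inE /=; apply/andP/idP => [[xy cxy]|xyE].
  have := cD1 (x, y); rewrite cxy finset.in_setU => /orP[/imsetP[z _ [xz yz]]|//].
  by rewrite xz yz eqxx in xy.
split; last exact: cE.
by apply: contraTneq xyE => ->; apply: admissible_offdiag.
Qed.

Lemma card_admissible n m : #|X| = n.+1 ->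
  #|[set E | admissible E && (#|E| == m)]| = ('C(n, m) * 'C(n + m, n))%N.
Proof.
move=> cX; apply: (@bin_square_unique n (fun m => #|[set E | admissible E && (#|E| == m)]|)) => N.
rewrite -(card_plans N cX) -sum1_card.
rewrite (partition_big (@off_supp N) admissible) /=; last by move=> c; rewrite inE => /andP[].
have -> : (\sum_(E | admissible E) \sum_(c in plans N | off_supp c == E) 1 =
           \sum_(E | admissible E) 'C(N + n, n + #|E|))%N.
  apply: eq_bigr => E aE; rewrite -(card_off_supp N cX aE) sum1dep_card.
  apply: eq_card => c; rewrite !inE -andbA; apply: andb_id2l => _.
  by apply/andP/idP => [[]//|/eqP ->].
(* Supports with more than [N] pairs contribute 0, so sizes can be indexed by ['I_N.+1]. *)
rewrite [RHS](bigID (fun E => #|E| <= N)%N) /= [X in _ = (_ + X)%N]big1 ?addn0; last first.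
  by move=> E /andP[_]; rewrite -ltnNge => EN; rewrite bin_small //; lia.
rewrite (partition_big (fun E => inord #|E| : 'I_N.+1) xpredT) //=.
apply: eq_bigr => k _; rewrite -sum_nat_const /=.
apply: eq_big => E.
  rewrite inE -andbA; apply: andb_id2l => _; apply/eqP/andP => [Ek|[EN /eqP Ek]].
    by rewrite Ek -ltnS ltn_ord; split=> //; apply/eqP/val_inj; rewrite /= inordK.
  by rewrite -Ek inordK.
by rewrite inE => /andP[_ /eqP ->].
Qed.

End Counting.

(** * Linear independence of tight edges *)

(** Made linear in the measure below, so that it can serve as the functional in [is_face]. *)
Definition pairing (R : realType) (X : finType) (f : X -> R)
    (v : {ffun X -> R^o}) : R := (\sum_x v x * f x)%R.

Lemma pairing_is_linear (R : realType) (X : finType) (f : X -> R) :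
  GRing.linear_for *%R (@pairing R X f).
Proof.
move=> a u v; rewrite /pairing mulr_sumr -big_split; apply: eq_bigr => x _ /=.
by rewrite !ffunE mulrDl -mulrA.
Qed.

HB.instance Definition _ (R : realType) (X : finType) (f : X -> R) :=
  GRing.isLinear.Build R {ffun X -> R^o} R *%R (@pairing R X f)
    (pairing_is_linear f).

Section ExposedEdges.
Local Open Scope classical_set_scope.
Local Open Scope ring_scope.
Context (R : realType) (X : finType) (rho : X -> X -> R).
Hypothesis rho_metric : is_metric rho.
Hypothesis rho_strict : strict_metric rho.
Implicit Types (f g : X -> R) (v : {ffun X -> R^o}).

Lemma rho_gt0 x y : x != y -> 0 < rho x y.
Proof.
case: rho_metric => r0 rE _ _ xy; rewrite lt_neqAle r0 andbT eq_sym.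
by apply: contraNneq xy => /rE ->.
Qed.

Lemma pairing_delta f x : pairing f (delta R x) = f x.
Proof.
rewrite /pairing (bigD1 x) //= ffunE eqxx mul1r big1 ?addr0 // => y /negbTE yx.
by rewrite ffunE yx mul0r.
Qed.

Lemma pairing_KR_point f x y :
  pairing f (KR_point rho x y) = (f x - f y) / rho x y.
Proof. by rewrite /KR_point linearZ linearB /= !pairing_delta mulrC. Qed.

Lemma pairing_KR_point_le1 f x y : lipschitz rho f -> x != y ->
  pairing f (KR_point rho x y) <= 1.
Proof.
by move=> lf xy; rewrite pairing_KR_point ler_pdivrMr ?rho_gt0 // mul1r lf.
Qed.

Lemma pairing_KR_point_eq1 f x y : x != y ->
  (pairing f (KR_point rho x y) == 1) = ((x, y) \in tight rho f).
Proof.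
move=> xy; rewrite pairing_KR_point inE /= xy /=.
by rewrite -(inj_eq (mulIf (lt0r_neq0 (rho_gt0 xy)))) divfK ?mul1r ?lt0r_neq0 ?rho_gt0.
Qed.

(** One minus the pairing is a weighted average of the nonnegative numbers [1 - pairing f (s i)], so
    it vanishes only if every term of nonzero weight does. *)
Lemma pairing_convex f (k : nat) (w : 'I_k -> R) (s : 'I_k -> {ffun X -> R^o}) :
    (forall i, 0 <= w i) -> \sum_i w i = 1 -> (forall i, pairing f (s i) <= 1) ->
  pairing f (\sum_i w i *: s i) <= 1 /\
  (pairing f (\sum_i w i *: s i) = 1 -> forall i, w i != 0 -> pairing f (s i) = 1).
Proof.
move=> w0 w1 s1.
have -> : pairing f (\sum_i w i *: s i) = 1 - \sum_i w i * (1 - pairing f (s i)).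
  rewrite linear_sum -[X in X - _]w1 -sumrB; apply: eq_bigr => i _.
  by rewrite linearZ /=; ring.
have p0 i : true -> 0 <= w i * (1 - pairing f (s i)) by rewrite mulr_ge0 ?subr_ge0.
split; first by rewrite lerBlDr lerDl sumr_ge0.
move=> e i wi; have e0 : \sum_i w i * (1 - pairing f (s i)) = 0 by move: e; lra.
have /eqP : w i * (1 - pairing f (s i)) = 0 := psumr_eq0P p0 e0 isT.
by rewrite mulf_eq0 (negbTE wi) /= subr_eq0 => /eqP.
Qed.

Lemma pairing_KR f v : lipschitz rho f -> KR rho v -> pairing f v <= 1.
Proof.
move=> lf [k [w [s [sK w0 w1 ->]]]]; apply: (pairing_convex w0 w1 _).1 => i.
by have [x [y [xy ->]]] := sK i; apply: pairing_KR_point_le1.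
Qed.

(* The witness averages the largest and the smallest 1-Lipschitz functions
   attaining the maximal difference on [(x, y)]. *)
Lemma tight_singleton x y : x != y ->
  exists2 g, lipschitz rho g & tight rho g = [set (x, y)]%SET.
Proof.
move=> xy; case: rho_metric => r0 rE rC rT.
have rxx z : rho z z = 0 by apply/rE.
pose g z := (rho z y - rho z x) / 2.
exists g => [a b|].
  by rewrite /g; have := rT a b y; have := rT b a x; rewrite (rC b a); lra.
apply/setP => -[a b]; rewrite !inE /= /g.
apply/andP/eqP => [[ab /eqP gab]|[-> ->]]; last first.
  by rewrite xy !rxx (rC y x); split=> //; apply/eqP; lra.
(* Tightness of [(a, b)] forces equality in both triangle inequalities, which strictness allows only
   for [b = y] and [a = x]. *)
have t1 := rT a b y; have t2 := rT b a x; rewrite (rC b a) in t2.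
have -> : b = y.
  apply/eqP/contraT => bY; have := @rho_strict a b y; rewrite eq_sym ab => /(_ isT bY).
  by move: gab; lra.
have -> // : a = x.
apply/eqP/contraT => ax; have := @rho_strict b a x ab ax.
by move: gab; rewrite (rC b a); lra.
Qed.

Lemma KR_point_inj : {in [pred e : X * X | e.1 != e.2] &,
  injective (fun e => KR_point rho e.1 e.2)}.
Proof.
move=> [x y] [x' y']; rewrite !inE /= => xy xy' e.
have [g _ gT] := tight_singleton xy.
have := pairing_KR_point_eq1 g xy'; rewrite -e pairing_KR_point_eq1 // gT !inE eqxx.
by move/esym/eqP.
Qed.

(** The functional of [g] reaches 1 at a single generator, which must carry all the weight of
    [v]. *)
Lemma KR_point_extreme v x y g : lipschitz rho g -> tight rho g = [set (x, y)]%SET ->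
  KR rho v -> pairing g v = 1 -> v = KR_point rho x y.
Proof.
move=> lg gT [k [w [s [sK w0 w1 vE]]]]; rewrite vE => e1.
have s1 i : pairing g (s i) <= 1.
  by have [a [b [ab ->]]] := sK i; apply: pairing_KR_point_le1.
have sE := (pairing_convex w0 w1 s1).2 e1.
rewrite (eq_bigr (fun i => w i *: KR_point rho x y)) => [|i _].
  by rewrite -scaler_suml w1 scale1r.
have [->|wi] := eqVneq (w i) 0; first by rewrite !scale0r.
have := sE i wi; have [a [b [ab ->]]] := sK i => /eqP.
by rewrite pairing_KR_point_eq1 // gT inE => /eqP[-> ->].
Qed.

Lemma KR_point_in x y : x != y -> KR rho (KR_point rho x y).
Proof.
move=> xy; exists 1%N, (fun=> 1), (fun=> KR_point rho x y); split => //.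
- by move=> _; exists x, y.
- by rewrite big_ord1.
- by rewrite big_ord1 scale1r.
Qed.

(** The midpoint of two opposite generators. It shows that a face on which a linear functional
    equals 1 is proper. *)
Lemma KR0 (x y : X) : x != y -> KR rho 0.
Proof.
move=> xy; exists 2%N, (fun=> 2^-1), (fun i : 'I_2 => if i == ord0 then KR_point rho x y else KR_point rho y x).
split => //.
- move=> i; case: ifP => _; [by exists x, y | by exists y, x; rewrite eq_sym].
- by move=> _; rewrite invr_ge0.
- by rewrite !big_ord_recl big_ord0 /=; lra.
- rewrite !big_ord_recl big_ord0 /= addr0 -scalerDr /KR_point.
  by case: rho_metric => _ _ -> _; rewrite -scalerDr -opprB addNr !scaler0.
Qed.

(** The tight pairs of [f] give points of the face of [KR] exposed by [f], which is a simplex. Each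
    is extreme, hence a vertex. A linear relation among the differences, rescaled by [rho], relates
    these vertices with coefficient sum 0, so affine independence makes it trivial. *)
Lemma simplicial_tight_independent (x0 x1 : X) : x0 != x1 -> simplicial (KR rho) ->
  forall f, lipschitz rho f -> independent R (tight rho f).
Proof.
move=> x01 simp f lf.
pose G := KR rho `&` [set v | pairing f v = 1].
have [k [s [s_free GE]]] : is_simplex G.
  apply: simp; first by exists (pairing f), 1; split=> // v; apply: pairing_KR.
  move=> GK; have : G 0 by rewrite GK; apply: KR0 x01.
  by case=> _; rewrite /= linear0 => /eqP; rewrite eq_sym oner_eq0.
have GKR u : G u -> KR rho u by case.
have Gs i : G (s i).
  rewrite GE; exists 1%N, (fun=> 1), (fun=> s i).
  by split=> //; rewrite big_ord1 ?scale1r.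
have ne e : e \in tight rho f -> e.1 != e.2 by rewrite inE => /andP[].
have idx_ex e : e \in tight rho f -> exists i, s i = KR_point rho e.1 e.2.
  case: e => x y eT; have xy := ne _ eT.
  have [g lg gT] := tight_singleton xy.
  have : G (KR_point rho x y).
    split; first exact: KR_point_in.
    by apply/eqP; rewrite pairing_KR_point_eq1.
  rewrite GE => -[p [w [t [tR w0 w1 pE]]]].
  have tG i : G (t i) by have [j _ <-] := tR i.
  have t1 i : pairing g (t i) <= 1 by apply: pairing_KR => //; apply: GKR.
  have e1 : pairing g (\sum_i w i *: t i) = 1.
    by rewrite -pE; apply/eqP; rewrite pairing_KR_point_eq1 // gT inE.
  (* Any point of nonzero weight also pairs to 1 with [g], so it is the exposed point itself. *)
  have [i wi] : exists i, w i != 0.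
    apply/existsP; apply: contraPT w1 => /existsPn wz.
    rewrite big1 => [/eqP|i _]; first by rewrite eq_sym oner_eq0.
    by apply/eqP; rewrite -[_ == _]negbK.
  have ti := (pairing_convex w0 w1 t1).2 e1 i wi.
  have [j _ tj] := tR i; exists j; rewrite tj.
  exact: KR_point_extreme lg gT (GKR _ (tG i)) ti.
move=> w wE e0 e0T; have [i0 _] := idx_ex e0 e0T.
pose idx e := odflt i0 [pick i | s i == KR_point rho e.1 e.2].
have idxE e : e \in tight rho f -> s (idx e) = KR_point rho e.1 e.2.
  move=> /idx_ex[i si]; rewrite /idx; case: pickP => [j /eqP//|/(_ i)].
  by rewrite si eqxx.
pose W i := \sum_(e in tight rho f | idx e == i) w e * rho e.1 e.2.
have W_sum : \sum_i W i = 0.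
  rewrite /W -(partition_big idx xpredT) //=.
  (* Pairing the relation [wE] with [f] turns each difference into a distance. *)
  transitivity (\sum_z f z * (\sum_(e in tight rho f) w e * ((z == e.1)%:R - (z == e.2)%:R))).
    2: by apply: big1 => z _; rewrite wE mulr0.
  under [RHS]eq_bigr do rewrite mulr_sumr.
  rewrite [RHS]exchange_big /=; apply: eq_bigr => e.
  rewrite inE => /andP[_ /eqP <-].
  rewrite -(pairing_delta f e.1) -(pairing_delta f e.2) /pairing -sumrB mulr_sumr.
  by apply: eq_bigr => z _; rewrite !ffunE; ring.
have W_comb : \sum_i W i *: s i = 0.
  have -> : \sum_i W i *: s i = \sum_(e in tight rho f) w e *: (delta R e.1 - delta R e.2).
    rewrite [RHS](partition_big idx xpredT) //=; apply: eq_bigr => i _.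
    rewrite scaler_suml; apply: eq_bigr => e /andP[eT /eqP <-].
    by rewrite idxE // /KR_point scalerA mulfK // lt0r_neq0 // rho_gt0 // ne.
  apply/ffunP => z; rewrite sum_ffunE ffunE -[RHS](wE z); apply: eq_bigr => e _.
  by rewrite !ffunE.
(* Distinct tight pairs have distinct indices, so [W (idx e0)] has a single term. *)
have := s_free W W_sum W_comb (idx e0); rewrite /W (big_pred1 e0) => [/eqP|e].
  by rewrite mulf_eq0 (gt_eqF (rho_gt0 (ne _ e0T))) orbF => /eqP.
apply/andP/eqP => [[eT /eqP ie]|->//].
apply: KR_point_inj; rewrite ?inE ?ne //.
by rewrite -!idxE // ie.
Qed.

End ExposedEdges.

(** * Faces of the Lipschitz polytope *)

(** An affine subspace has the same direction space from every base point. *)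
Lemma has_dim_unique (R : realType) (V : vectType R) (S : set V) (d d' : nat) :
  has_dim S d -> has_dim S d' -> d = d'.
Proof.
move=> [p [U [SU <-]]] [p' [U' [SU' <-]]]; congr (\dim _).
have /seteqP[sub sub'] : ([set v | v - p \in U] = [set v | v - p' \in U'])%classic%R.
  by rewrite -SU.
have UU v : (v - p \in U)%R = (v - p' \in U')%R.
  by apply/idP/idP; [exact: sub | exact: sub'].
have pU' : (p - p' \in U')%R by rewrite -UU subrr mem0v.
apply/vspaceP => v; have := UU (v + p)%R; rewrite addrK => ->.
by rewrite -addrA rpredDr.
Qed.

Section Faces.
Local Open Scope classical_set_scope.
Local Open Scope ring_scope.
Context (R : realType) (X : finType) (rho : X -> X -> R) (x0 : X).
Hypothesis rho_metric : is_metric rho.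
Hypothesis tight_independent :
  forall f, lipschitz rho f -> independent R (tight rho f).
Implicit Types (f g h : {ffun X -> R^o}) (E : {set X * X}).

Lemma LIPP f : LIP rho x0 f <-> f x0 = 0 /\ lipschitz rho f.
Proof.
case: rho_metric => _ _ rC _; split=> -[f0 lf]; split=> // x y.
  by apply: le_trans (lf x y); apply: ler_norm.
by rewrite ler_norml lf andbT lerNl opprB rC lf.
Qed.

Definition face_of E : set {ffun X -> R^o} :=
  [set f | LIP rho x0 f /\ forall e, e \in E -> f e.1 - f e.2 = rho e.1 e.2].

Lemma in_tight f e : e \in tight rho f -> f e.1 - f e.2 = rho e.1 e.2.
Proof. by rewrite inE => /andP[_ /eqP]. Qed.

Lemma face_of_tight f g : LIP rho x0 g ->
  face_of (tight rho f) g <-> tight rho f \subset tight rho g.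
Proof.
move=> lg; split=> [[_ gE]|/fintype.subsetP s].
  apply/fintype.subsetP => e eT; rewrite inE gE // eqxx andbT.
  by move: eT; rewrite inE => /andP[].
by split=> // e /s; apply: in_tight.
Qed.

Lemma admissible_LIP E : admissible rho E ->
  exists2 f, LIP rho x0 f & tight rho f = E.
Proof.
move=> /asboolP[f lf <-]; exists [ffun x => f x - f x0].
  apply/LIPP; rewrite ffunE subrr; split=> // x y.
  by rewrite !ffunE opprB addrA subrK.
by apply/setP => e; rewrite !inE !ffunE opprB addrA subrK.
Qed.

(** A function with tight set exactly [E] lies in [face_of E'] only if [E'] is contained in [E]. *)
Lemma face_of_inj : {in admissible rho &, injective face_of}.
Proof.
move=> E E' aE aE' EE'.
have [f lf fE] := admissible_LIP aE; have [f' lf' f'E'] := admissible_LIP aE'.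
apply/eqP; rewrite finset.eqEsubset; apply/andP; split.
  have : face_of E f' by rewrite EE' -f'E'; apply/face_of_tight.
  by rewrite -{1}fE => /(face_of_tight _ lf'); rewrite fE f'E'.
have : face_of E' f by rewrite -EE' -fE; apply/face_of_tight.
by rewrite -{1}f'E' => /(face_of_tight _ lf); rewrite fE f'E'.
Qed.

(** Summing the inequalities indexed by [E] gives the supporting functional; the sum is an equality
    only if each term is. *)
Lemma face_ofP E : is_face (LIP rho x0) (face_of E).
Proof.
pose m (z : X) : R := \sum_(e in E) ((z == e.1)%:R - (z == e.2)%:R).
have mE f : pairing m f = \sum_(e in E) (f e.1 - f e.2).
  rewrite /pairing /m; under eq_bigr do rewrite mulr_sumr.
  rewrite exchange_big /=; apply: eq_bigr => e _.
  under eq_bigr do rewrite mulrBr.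
  rewrite sumrB; congr (_ - _).
    rewrite (bigD1 e.1) //= eqxx mulr1 big1 ?addr0 // => z /negbTE ->.
    by rewrite mulr0.
  rewrite (bigD1 e.2) //= eqxx mulr1 big1 ?addr0 // => z /negbTE ->.
  by rewrite mulr0.
exists (pairing m), (\sum_(e in E) rho e.1 e.2); split=> [f /LIPP[_ lf]|].
  by rewrite /= mE; apply: ler_sum.
apply/seteqP; split=> f /= [lf fE]; split=> //.
  by rewrite /= mE; apply: eq_bigr.
move=> e eE; have [_ lf'] := (LIPP f).1 lf.
have s0 : \sum_(e in E) (rho e.1 e.2 - (f e.1 - f e.2)) = 0.
  by move: fE; rewrite sumrB -mE => ->; rewrite subrr.
have p0 e' : e' \in E -> 0 <= rho e'.1 e'.2 - (f e'.1 - f e'.2) by rewrite subr_ge0.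
have : rho e.1 e.2 - (f e.1 - f e.2) = 0 := psumr_eq0P p0 s0 eE.
by move/eqP; rewrite subr_eq0 => /eqP ->.
Qed.

Lemma LIP_perturb f h : LIP rho x0 f -> h x0 = 0 ->
    (forall e, e \in tight rho f -> h e.1 = h e.2) ->
  exists2 eps : R, 0 < eps & face_of (tight rho f) (f + eps *: h).
Proof.
move=> /LIPP[f0 lf] h0 hT.
have [e /hT -> //|eps eps0 [lg gT]] := lipschitz_perturb (h := h) lf.
exists eps => //; split.
  apply/LIPP; split; first by rewrite !ffunE f0 h0 [eps *: _]mulr0 addr0.
  by move=> x y; rewrite !ffunE; apply: lg.
move=> e eT; rewrite -(in_tight eT) !ffunE hT //.
by rewrite opprD addrACA subrr addr0.
Qed.

(* A point of the face with fewest tight pairs lies in its relative interior. *)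
Lemma face_is_face_of G f0 : is_face (LIP rho x0) G -> G f0 ->
  exists2 E, admissible rho E & G = face_of E.
Proof.
move=> [l [b [lb GE]]] Gf0.
pose P n := `[< exists2 f, G f & #|tight rho f| = n >].
have exP : exists n, P n by exists #|tight rho f0|; apply/asboolP; exists f0.
case: (ex_minnP exP) => n /asboolP[f Gf fn] fmin.
have GL g : G g -> LIP rho x0 g by rewrite GE => -[].
have Gl g : G g -> l g = b by rewrite GE => -[].
have [f00 lf] := (LIPP f).1 (GL _ Gf).
have sub g : G g -> tight rho f \subset tight rho g.
  move=> Gg; have [g0 lg] := (LIPP g).1 (GL _ Gg).
  (* The midpoint is tight only where both [f] and [g] are, so minimality forces its tight set to be
     that of [f]. *)
  pose k : {ffun X -> R^o} := 2^-1 *: (f + g).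
  have kE x : k x = (f x + g x) / 2 by rewrite !ffunE mulrC.
  have Gk : G k.
    rewrite GE; split.
      apply/LIPP; split; first by rewrite kE f00 g0 addr0 mul0r.
      by move=> x y; rewrite !kE; have := lf x y; have := lg x y; lra.
    by rewrite /= linearZ /= linearD /= (Gl f) // (Gl g) //; lra.
  have kT e : e \in tight rho k -> e \in tight rho f /\ e \in tight rho g.
    rewrite !inE !kE => /andP[-> /eqP ke] /=.
    by have := lf e.1 e.2; have := lg e.1 e.2; split; apply/eqP; lra.
  have kf : tight rho k = tight rho f.
    apply/eqP; rewrite eqEcard; apply/andP; split.
      by apply/fintype.subsetP => e /kT[].
    by rewrite fn; apply: fmin; apply/asboolP; exists k.
  by rewrite -kf; apply/fintype.subsetP => e /kT[].
exists (tight rho f); first by apply/asboolP; exists f.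
apply/seteqP; split=> [g Gg|g [Lg gT]].
  by apply/(face_of_tight _ (GL _ Gg)); apply: sub.
rewrite GE; split=> //=; apply/eqP; rewrite eq_le lb //=.
have [g0 _] := (LIPP g).1 Lg.
(* Moving from [f] slightly away from [g] stays in the polytope, so [l g < b] would push [l] above
   [b]. *)
have [||eps eps0 [Lk _]] := @LIP_perturb f (f - g) (GL _ Gf).
- by rewrite !ffunE f00 g0 subrr.
- by move=> e eT; rewrite !ffunE; have := gT _ eT; rewrite -(in_tight eT); lra.
have := lb _ Lk; rewrite linearD linearZ /= linearB /= (Gl f) // gerDl.
by rewrite pmulr_rle0 // subr_le0.
Qed.

(** The coordinate [None] records the value at [x0], so that the kernel consists of functions
    vanishing there. *)
Definition edge_diff E (h : {ffun X -> R^o}) : {ffun option {e | e \in E} -> R^o} :=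
  [ffun o => if o is Some e then h (val e).1 - h (val e).2 else h x0].

Lemma edge_diff_is_linear E : linear (@edge_diff E).
Proof.
move=> a u v; apply/ffunP => -[e|]; rewrite !ffunE //=.
by rewrite [in RHS]scalerBr; ring.
Qed.

HB.instance Definition _ E :=
  GRing.isLinear.Build R {ffun X -> R^o} {ffun option {e | e \in E} -> R^o} _
    (@edge_diff E) (@edge_diff_is_linear E).

Lemma dim_ffun (I : finType) : \dim (fullv : {vspace {ffun I -> R^o}}) = #|I|.
Proof. by rewrite dimvf /dim /= muln1. Qed.

Lemma edge_kernel E h : (h \in lker (linfun (@edge_diff E))) <->
  (h x0 = 0 /\ forall e, e \in E -> h e.1 = h e.2).
Proof.
rewrite memv_ker lfunE /=; split.
  move=> /eqP/ffunP hE; split; first by have := hE None; rewrite !ffunE.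
  move=> e eE; have := hE (Some (exist _ e eE)); rewrite !ffunE /= => /eqP.
  by rewrite subr_eq0 => /eqP.
move=> [h0 hE]; apply/eqP/ffunP => -[[e eE]|]; rewrite !ffunE //=.
by rewrite hE // subrr.
Qed.

(** Rank-nullity: independence makes [edge_diff] onto a space of dimension [#|E| + 1]. *)
Lemma dim_edge_kernel n E : #|X| = n.+1 -> independent R E ->
  (\dim (lker (linfun (@edge_diff E))) + #|E| = n)%N.
Proof.
move=> cX iE; have := limg_ker_dim (linfun (@edge_diff E)) fullv.
rewrite capfv dim_ffun cX.
have -> : (linfun (@edge_diff E) @: fullv = fullv)%VS.
  apply/vspaceP => t; rewrite memvf; apply/memv_imgP.
  have [h hE] := independent_prescribe iE
    (fun e => if insub e is Some e' then t (Some e') else 0).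
  (* A constant shift sets the value at [x0] without affecting differences. *)
  exists [ffun x => h x - h x0 + t None]; first exact: memvf.
  rewrite lfunE; apply/ffunP => -[[e eE]|]; rewrite !ffunE /=; last by rewrite subrr add0r.
  have := hE e eE; rewrite insubT => <-.
  by ring.
rewrite dim_ffun card_option card_sig addnS => -[<-].
by congr (_ + _)%N; apply: eq_card.
Qed.

(** The affine hull is a translate of the kernel: differences along [E] are fixed on the face, and
    from a function tight exactly on [E] every kernel direction can be followed a little way. *)
Lemma face_of_has_dim n E : #|X| = n.+1 -> admissible rho E ->
  (#|E| <= n)%N /\ has_dim (face_of E) (n - #|E|)%N.
Proof.
move=> cX aE; have [f Lf fE] := admissible_LIP aE.
have [f0 lf] := (LIPP f).1 Lf.
have iE : independent R E by rewrite -fE; apply: tight_independent.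
have dE := dim_edge_kernel cX iE.
split; first by rewrite -dE leq_addl.
exists f, (lker (linfun (@edge_diff E))); split; last by rewrite -dE addnK.
have Ff : face_of E f by split=> // e; rewrite -fE; apply: in_tight.
apply/seteqP; split=> v /=.
  move=> [k [w [s [sF w1 ->]]]]; apply/edge_kernel.
  have val_sum x : (\sum_i w i *: s i) x = \sum_i w i * s i x.
    by rewrite sum_ffunE; apply: eq_bigr => i _; rewrite ffunE.
  split.
    rewrite !ffunE val_sum f0 subr0 big1 // => i _.
    by have [/LIPP[-> _] _] := sF i; rewrite mulr0.
  move=> e eE; apply/eqP; rewrite -subr_eq0 !ffunE !val_sum.
  have -> : \sum_i w i * s i e.1 = \sum_i w i * s i e.2 + (f e.1 - f e.2).
    have [_ /(_ e eE) ->] := Ff.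
    rewrite -[rho _ _]mul1r -w1 mulr_suml -big_split; apply: eq_bigr => i _ /=.
    by have [_ /(_ e eE) <-] := sF i; ring.
  by apply/eqP; ring.
move=> /edge_kernel[h0 hE].
have [|eps eps0 Fk] := LIP_perturb Lf h0; first by rewrite fE.
rewrite fE in Fk.
(* [v] lies on the line through two points of the face, [f] and [f + eps *: (v - f)], at parameter
   [eps^-1]. *)
exists 2%N, (fun i : 'I_2 => if i == ord0 then 1 - eps^-1 else eps^-1),
  (fun i : 'I_2 => if i == ord0 then f else f + eps *: (v - f)).
split.
- by move=> i; case: ifP.
- by rewrite !big_ord_recl big_ord0 /=; ring.
- rewrite !big_ord_recl big_ord0 /= addr0 scalerDr scalerA mulVf ?lt0r_neq0 //.
  by rewrite scale1r addrA -scalerDl subrK scale1r addrCA subrr addr0.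
Qed.

End Faces.

(** * Counting the faces *)

Local Open Scope classical_set_scope.
Local Open Scope ring_scope.
Local Open Scope card_scope.

(* The quotient of factorials below is an exact division in nat. *)
Theorem theorem1 (R : realType) (n : nat) (X : finType) (rho : X -> X -> R)
    (x0 : X) (m : nat) :
  (1 <= n)%N ->
  #|X| = n.+1 ->
  is_metric rho ->
  generic_metric rho ->
  (m <= n)%N ->
  [set G : set {ffun X -> R^o} |
     is_face (LIP rho x0) G /\ has_dim G (n - m)%N]
  #= `I_((n + m)`! %/ (m`! * m`! * (n - m)`!))%N.
Proof.
move=> n1 cX rho_metric [rho_strict rho_simp] mn.
have [x1 x01] : exists x1, x0 != x1.
  apply/existsP; apply: contraLR n1 => /existsPn xx; rewrite -ltnNge ltnS -ltnS -cX.
  rewrite (fintype.eq_card1 (x := x0)) // => x; rewrite !inE.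
  by have := xx x; rewrite negbK eq_sym => ->.
have tight_independent := simplicial_tight_independent rho_metric rho_strict x01 rho_simp.
pose S := [set E : {set X * X} | admissible rho E && (#|E| == m)]%SET.
have -> : [set G | is_face (LIP rho x0) G /\ has_dim G (n - m)%N]
    = face_of rho x0 @` [set` S].
  apply/seteqP; split=> [G [faceG dimG]|_ [E + <-]] /=; last first.
    rewrite /= inE => /andP[aE /eqP Em]; split; first exact: face_ofP.
    by rewrite -Em; apply: (face_of_has_dim x0 rho_metric tight_independent cX aE).2.
  (* A set with a dimension is nonempty, since an empty family of weights cannot sum to 1. *)
  have [f Gf] : exists f, G f.
    case: dimG => p [U [GU _]]; have : affine_hull G p by rewrite GU /= subrr mem0v.
    case=> -[|k] [w [s [Gs w1 _]]]; last by exists (s ord0).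
    by move: w1; rewrite big_ord0 => /eqP; rewrite eq_sym oner_eq0.
  have [E aE GE] := face_is_face_of rho_metric faceG Gf.
  exists E => //=; rewrite inE aE /=; apply/eqP.
  have [En dimE] := face_of_has_dim x0 rho_metric tight_independent cX aE.
  (* Truncated subtraction loses nothing, as [#|E|] and [m] are both at most [n]. *)
  rewrite -GE in dimE; apply: etrans (esym (subKn En)) _.
  by rewrite -(has_dim_unique dimG dimE) subKn.
have -> : ((n + m)`! %/ (m`! * m`! * (n - m)`!))%N = #|S|.
  rewrite (card_admissible tight_independent rho_metric rho_strict m cX).
  have e1 := bin_fact mn; have e2 := bin_fact (leq_addr m n); rewrite addKn in e2.
  rewrite -e2 -e1; set D := (m`! * m`! * (n - m)`!)%N.
  have D0 : (0 < D)%N by rewrite !muln_gt0 !fact_gt0.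
  rewrite -[RHS](mulnK _ D0) /D; congr (_ %/ _)%N.
  by ring.
apply: card_eq_trans (inj_card_eq _) _.
  move=> E E' /set_mem /= + /set_mem /=; rewrite !inE => /andP[aE _] /andP[aE' _].
  exact: (face_of_inj rho_metric).
have -> : [set` S] = enum_val @` [set: 'I_#|S|].
  apply/seteqP; split=> [E ES|_ [i _ <-]] /=; last exact: enum_valP.
  by exists (enum_rank_in ES E) => //; rewrite enum_rankK_in.
apply: card_eq_trans (inj_card_eq _) _; first by move=> i j _ _; apply: enum_val_inj.
by rewrite card_eq_sym; exact: card_II.
Qed.
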